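(* For every set of formulas $\Gamma\cup\{A\}$ over $\Sigma_1$: $\Gamma\vdash_{LET_F^+}A$ if and only if $\Gamma\models_{Mat(LET_F^+)}A$.
   Context: Formulas are built from a denumerable set of propositional variables over $\Sigma_1=\{\land,\lor,\neg,\circ\}$. $LET_F^+$ is the natural deduction system with rules: ($\land$I) from $A,B$ infer $A\land B$; ($\land$E) from $A\land B$ infer $A$ and $B$; ($\lor$I) from $A$ (or $B$) infer $A\lor B$; ($\lor$E) from $A\lor B$ and derivations of $C$ from $[A]$ and from $[B]$ infer $C$ (discharging); ($\neg\land$I) from $\neg A$ (or $\neg B$) infer $\neg(A\land B)$; ($\neg\land$E) from $\neg(A\land B)$ and derivations of $C$ from $[\neg A]$ and from $[\neg B]$ infer $C$; ($\neg\lor$I) from $\neg A,\neg B$ infer $\neg(A\lor B)$; ($\neg\lor$E) from $\neg(A\lor B)$ infer $\neg A$ and $\neg B$; (DN) $A$ and $\neg\neg A$ inter-derivable; (EXP$^\circ$) from $\circ A,A,\neg A$ infer $B$; (PEM$^\circ$) from $\circ A$ infer $A\lor\neg A$; and, writing $A^T$ for $\circ A\land A$ and $A^F$ for $\circ A\land\neg A$: (I$\circ$) axiom $\circ\circ A$; (I$\neg\circ$) from $\circ A$ infer $\circ\neg A$; (E$\neg\circ$) from $\circ\neg A$ infer $\circ A$; (I$\land$T) from $A^T,B^T$ infer $(A\land B)^T$; (I$\land$F) from $A^F$ (or $B^F$) infer $(A\land B)^F$; (I$\lor$T) from $A^T$ (or $B^T$) infer $(A\lor B)^T$; (I$\lor$F)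 from $A^F,B^F$ infer $(A\lor B)^F$; (E$\land$T) from $(A\land B)^T$ infer $A^T$ and $B^T$; (E$\land$F) from $(A\land B)^F$ and derivations of $C$ from $[A^F]$ and from $[B^F]$ infer $C$; (E$\lor$T) from $(A\lor B)^T$ and derivations of $C$ from $[A^T]$ and from $[B^T]$ infer $C$; (E$\lor$F) from $(A\lor B)^F$ infer $A^F$ and $B^F$. For a Boolean algebra $\mathcal{B}=\langle\mathbf{B},\sqcap,\sqcup,\Rightarrow,\sim,0,1\rangle$, let $\mathcal{T}^1_\mathcal{B}$ be the algebra over $\Sigma_1$ with domain $\{z\in\mathbf{B}^3:z_3\le z_1\sqcup z_2,\ z_1\sqcap z_2\sqcap z_3=0\}$ and operations $z\tilde\land w=(z_1\sqcap w_1,\ z_2\sqcup w_2,\ (z_1\sqcap z_3\sqcap w_1\sqcap w_3)\sqcup(z_2\sqcap z_3)\sqcup(w_2\sqcap w_3))$; $z\tilde\lor w=(z_1\sqcup w_1,\ z_2\sqcap w_2,\ (z_2\sqcap z_3\sqcap w_2\sqcap w_3)\sqcup(z_1\sqcap z_3)\sqcup(w_1\sqcap w_3))$; $\tilde\neg z=(z_2,z_1,z_3)$; $\tilde\circ z=(z_3,\sim z_3,1)$. $\mathcal{M}^1(\mathcal{B})$ is the logical matrix $\langle\mathcal{T}^1_\mathcal{B},\{z:z_1=1\}\rangle$; $Mat(LET_F^+)$ is the class of all $\mathcal{M}^1(\mathcal{B})$ for Boolean algebras $\mathcal{B}$, and $\Gamma\models_{Mat(LET_F^+)}A$ iff for every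 such matrix and every homomorphism $v$ from formulas into $\mathcal{T}^1_\mathcal{B}$, if $v(B)$ is designated for all $B\in\Gamma$ then $v(A)$ is designated. *)

(* Defs.v *)
From mathcomp Require Import all_boot all_order.
From mathcomp Require Import boolp classical_sets.

Set Implicit Arguments.
Unset Strict Implicit.
Unset Printing Implicit Defensive.

Import Order.Theory.

Inductive formula : Type :=
| Var of nat
| And of formula & formula
| Or of formula & formula
| Neg of formula
| Circ of formula.

Declare Scope form_scope.
Delimit Scope form_scope with F.
Bind Scope form_scope with formula.
Notation "A ∧ B" := (And A B) (at level 40, left associativity) : form_scope.
Notation "A ∨ B" := (Or A B) (at level 50, left associativity) : form_scope.
Notation "¬ A" := (Neg A) (at level 35, right associativity) : form_scope.
Notation "∘ A" := (Circ A) (at level 35, right associativity) : form_scope.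
Notation "A ^T" := (And (Circ A) A) (at level 8, format "A ^T") : form_scope.
Notation "A ^F" := (And (Circ A) (Neg A)) (at level 8, format "A ^F") : form_scope.

(* [G ⊢ A] holds iff there is a natural deduction derivation of A all of whose
   undischarged assumptions belong to the (possibly infinite) set G;
   [G, A] is G together with the dischargeable assumption A. *)
Reserved Notation "G ⊢ A" (at level 70, no associativity).
Local Notation "G ,, A" := (setU G (set1 A)) (at level 65, left associativity).

Inductive derives : set formula -> formula -> Prop :=
| Hyp (G : set formula) A : G A -> G ⊢ A
| AndI G A B : G ⊢ A -> G ⊢ B -> G ⊢ A ∧ B
| AndE1 G A B : G ⊢ A ∧ B -> G ⊢ A
| AndE2 G A B : G ⊢ A ∧ B -> G ⊢ B
| OrI1 G A B : G ⊢ A -> G ⊢ A ∨ B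
| OrI2 G A B : G ⊢ B -> G ⊢ A ∨ B
| OrE G A B C : G ⊢ A ∨ B -> G ,, A ⊢ C -> G ,, B ⊢ C -> G ⊢ C
| NegAndI1 G A B : G ⊢ ¬ A -> G ⊢ ¬ (A ∧ B)
| NegAndI2 G A B : G ⊢ ¬ B -> G ⊢ ¬ (A ∧ B)
| NegAndE G A B C :
    G ⊢ ¬ (A ∧ B) -> G ,, (¬ A)%F ⊢ C -> G ,, (¬ B)%F ⊢ C -> G ⊢ C
| NegOrI G A B : G ⊢ ¬ A -> G ⊢ ¬ B -> G ⊢ ¬ (A ∨ B)
| NegOrE1 G A B : G ⊢ ¬ (A ∨ B) -> G ⊢ ¬ A
| NegOrE2 G A B : G ⊢ ¬ (A ∨ B) -> G ⊢ ¬ B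
| DNI G A : G ⊢ A -> G ⊢ ¬ ¬ A
| DNE G A : G ⊢ ¬ ¬ A -> G ⊢ A
| EXPcirc G A B : G ⊢ ∘ A -> G ⊢ A -> G ⊢ ¬ A -> G ⊢ B
| PEMcirc G A : G ⊢ ∘ A -> G ⊢ A ∨ ¬ A
| CircI G A : G ⊢ ∘ ∘ A
| NegCircI G A : G ⊢ ∘ A -> G ⊢ ∘ ¬ A
| NegCircE G A : G ⊢ ∘ ¬ A -> G ⊢ ∘ A
| AndTI G A B : G ⊢ A^T -> G ⊢ B^T -> G ⊢ (A ∧ B)^T
| AndFI1 G A B : G ⊢ A^F -> G ⊢ (A ∧ B)^F
| AndFI2 G A B : G ⊢ B^F -> G ⊢ (A ∧ B)^F
| OrTI1 G A B : G ⊢ A^T -> G ⊢ (A ∨ B)^T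
| OrTI2 G A B : G ⊢ B^T -> G ⊢ (A ∨ B)^T
| OrFI G A B : G ⊢ A^F -> G ⊢ B^F -> G ⊢ (A ∨ B)^F
| AndTE1 G A B : G ⊢ (A ∧ B)^T -> G ⊢ A^T
| AndTE2 G A B : G ⊢ (A ∧ B)^T -> G ⊢ B^T
| AndFE G A B C :
    G ⊢ (A ∧ B)^F -> G ,, (A^F)%F ⊢ C -> G ,, (B^F)%F ⊢ C -> G ⊢ C
| OrTE G A B C :
    G ⊢ (A ∨ B)^T -> G ,, (A^T)%F ⊢ C -> G ,, (B^T)%F ⊢ C -> G ⊢ C
| OrFE1 G A B : G ⊢ (A ∨ B)^F -> G ⊢ A^F
| OrFE2 G A B : G ⊢ (A ∨ B)^F -> G ⊢ B^F
where "G ⊢ A" := (derives G A%F).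

Record sigma1_alg := Sigma1Alg {
  carrier :> Type;
  aand : carrier -> carrier -> carrier;
  aor : carrier -> carrier -> carrier;
  aneg : carrier -> carrier;
  acirc : carrier -> carrier }.

Definition is_hom (T : sigma1_alg) (v : formula -> T) : Prop :=
  [/\ forall A B, v (A ∧ B)%F = aand (v A) (v B),
      forall A B, v (A ∨ B)%F = aor (v A) (v B),
      forall A, v (¬ A)%F = aneg (v A)
    & forall A, v (∘ A)%F = acirc (v A)].

Record log_matrix := LogMatrix {
  matrix_alg :> sigma1_alg;
  designated : set matrix_alg }.

Definition entails (K : log_matrix -> Prop) (G : set formula) (A : formula) :=
  forall M : log_matrix, K M -> forall v : formula -> M, is_hom v ->
    (forall B, G B -> designated (v B)) -> designated (v A).

Section Twist.
Local Open Scope order_scope.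
Context (d : Order.disp_t) (B : ctbDistrLatticeType d).

Definition snapshot_pred (z : B * B * B) : bool :=
  let: (z1, z2, z3) := z in (z3 <= z1 `|` z2) && (z1 `&` z2 `&` z3 == \bot).

Definition and_raw (z w : B * B * B) : B * B * B :=
  let: (z1, z2, z3) := z in let: (w1, w2, w3) := w in
  (z1 `&` w1, z2 `|` w2,
   (z1 `&` z3 `&` w1 `&` w3) `|` (z2 `&` z3) `|` (w2 `&` w3)).

Definition or_raw (z w : B * B * B) : B * B * B :=
  let: (z1, z2, z3) := z in let: (w1, w2, w3) := w in
  (z1 `|` w1, z2 `&` w2,
   (z2 `&` z3 `&` w2 `&` w3) `|` (z1 `&` z3) `|` (w1 `&` w3)).

Definition neg_raw (z : B * B * B) : B * B * B :=
  let: (z1, z2, z3) := z in (z2, z1, z3).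

Definition circ_raw (z : B * B * B) : B * B * B :=
  let: (z1, z2, z3) := z in (z3, ~` z3, \top).

Lemma neg_rawP z : snapshot_pred z -> snapshot_pred (neg_raw z).
Proof. by case: z => [[a b] c] /=; rewrite joinC (meetC a). Qed.

Lemma circ_rawP z : snapshot_pred z -> snapshot_pred (circ_raw z).
Proof. by case: z => [[a b] c] _ /=; rewrite joinxC lexx meetxC meet0x eqxx. Qed.

Local Ltac meet_le :=
  solve [exact: lexx | apply: leIxl; meet_le | apply: leIxr; meet_le].

Lemma and_rawP z w :
  snapshot_pred z -> snapshot_pred w -> snapshot_pred (and_raw z w).
Proof.
case: z w => [[a b] c] [[a' b'] c'] /= /andP[_ /eqP z0] /andP[_ /eqP w0].
apply/andP; split.
  rewrite !leUx; apply/andP; split; first (apply/andP; split).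
  - by apply: lexUl; rewrite -(meetA (a `&` c)) meetACA leIl.
  - by apply: lexUr; apply: lexUl; apply: leIl.
  - by apply: lexUr; apply: lexUr; apply: leIl.
rewrite !(meetUl, meetUr) -lex0 !leUx.
by do ![apply/andP; split];
  first [by rewrite -z0 !lexI; do ![apply/andP; split]; meet_le
        |by rewrite -w0 !lexI; do ![apply/andP; split]; meet_le].
Qed.

Lemma or_raw_dual z w : or_raw z w = neg_raw (and_raw (neg_raw z) (neg_raw w)).
Proof. by case: z w => [[a b] c] [[a' b'] c']. Qed.

Lemma or_rawP z w :
  snapshot_pred z -> snapshot_pred w -> snapshot_pred (or_raw z w).
Proof.
by move=> sz sw; rewrite or_raw_dual neg_rawP // and_rawP // neg_rawP.
Qed.

Definition snapshot : Type := {z : B * B * B | snapshot_pred z}.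

Definition twist_alg : sigma1_alg := {|
  carrier := snapshot;
  aand := fun z w => exist _ (and_raw (val z) (val w)) (and_rawP (valP z) (valP w));
  aor := fun z w => exist _ (or_raw (val z) (val w)) (or_rawP (valP z) (valP w));
  aneg := fun z => exist _ (neg_raw (val z)) (neg_rawP (valP z));
  acirc := fun z => exist _ (circ_raw (val z)) (circ_rawP (valP z)) |}.

Definition twist_matrix : log_matrix := {|
  matrix_alg := twist_alg;
  designated := fun z : snapshot => (val z).1.1 = \top |}.

End Twist.

Inductive Mat : log_matrix -> Prop :=
| Mat_twist (d : Order.disp_t) (B : ctbDistrLatticeType d) :
    Mat (twist_matrix B).

(* Main.v *)
Require Import Defs.
From mathcomp Require Import all_boot all_order.
From mathcomp Require Import boolp classical_sets.

(** Soundness: since only the top of the Boolean algebra is designated, the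
    induction on derivations needs a stronger hypothesis than preservation of
    designation, because of the rules that discharge assumptions.  One shows
    that every lower bound [b] of the first components of the premises is a
    lower bound of the first component of the conclusion; a case split on
    [b <= x ⊔ y] then uses the induction hypotheses at [b ⊓ x] and [b ⊓ y].

    Completeness: if [A] is not derivable from [Gamma], Zorn's lemma extends
    [Gamma] to a set [D] maximal among those not deriving [A].  It is closed
    under derivation and prime, so [B |-> (B ∈ D, ¬B ∈ D, ∘B ∈ D)] is a
    valuation into the twist structure over the two-element Boolean algebra
    that refutes the entailment. *)

Set Implicit Arguments.
Unset Strict Implicit.
Unset Printing Implicit Defensive.

Import Order.Theory.

Local Open Scope classical_set_scope.
Local Notation "G ,, A" := (setU G (set1 A)) (at level 65, left associativity).

(** * Inequalities in a Boolean algebra mirroring the rules *)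

Section TwistOrder.
Local Open Scope order_scope.
Context (d : Order.disp_t) (B : ctbDistrLatticeType d).
Implicit Types b c x y z : B.

Local Ltac meet_le :=
  solve [assumption | apply: lexx | apply: leIxl; meet_le
        | apply: leIxr; meet_le].

(** Disjunction elimination in the lattice: by distributivity [b] is the join of its meets with [x]
    and [y]. Every discharging rule goes through it. *)
Lemma le_joinE b c x y :
  b <= x `|` y -> b `&` x <= c -> b `&` y <= c -> b <= c.
Proof.
by move=> /meet_idPl bxy bx yb; rewrite -bxy meetUr leUx bx.
Qed.

Lemma le_meet3_bot x1 x2 x3 b z :
  x1 `&` x2 `&` x3 = \bot -> b <= x1 -> b <= x2 -> b <= x3 -> b <= z.
Proof.
move=> x0 b1 b2 b3; apply: (@le_trans _ _ \bot); last exact: le0x.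
by rewrite -x0 !lexI b1 b2 b3.
Qed.

(* The third component of [and_raw]; exchanging the roles of [x1, y1] and
   [x2, y2] gives that of [or_raw]. *)
Definition circ_and x1 x2 x3 y1 y2 y3 : B :=
  (x1 `&` x3 `&` y1 `&` y3) `|` (x2 `&` x3) `|` (y2 `&` y3).

Section CircAnd.
Context (x1 x2 x3 y1 y2 y3 : B).
Local Notation circ := (circ_and x1 x2 x3 y1 y2 y3).

Lemma le_circ_andT b :
  b <= x3 `&` x1 -> b <= y3 `&` y1 -> b <= circ `&` (x1 `&` y1).
Proof.
rewrite !lexI => /andP[b3 b1] /andP[b6 b4]; rewrite b1 b4 !andbT.
by do 2![apply: lexUl]; rewrite !lexI b1 b3 b4 b6.
Qed.

Lemma le_circ_andF1 b : b <= x3 `&` x2 -> b <= circ `&` (x2 `|` y2).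
Proof.
rewrite !lexI => /andP[b3 b2]; apply/andP; split; last exact: lexUl.
by apply: lexUl; apply: lexUr; rewrite lexI b2 b3.
Qed.

Lemma le_circ_andF2 b : b <= y3 `&` y2 -> b <= circ `&` (x2 `|` y2).
Proof.
rewrite !lexI => /andP[b3 b2]; apply/andP; split; last exact: lexUr.
by apply: lexUr; rewrite lexI b2 b3.
Qed.

Hypotheses (x0 : x1 `&` x2 `&` x3 = \bot) (y0 : y1 `&` y2 `&` y3 = \bot).

(** Splits [b] along the three joinands of [circ]. In the last two, [b] also lies below [x1] and
    [y1], so [x0] or [y0] sends that part to the bottom; only the first joinand survives. *)
Lemma circ_andT_le b :
  b <= circ `&` (x1 `&` y1) -> b <= (x3 `&` x1) `&` (y3 `&` y1).
Proof.
rewrite !(lexI b) -!andbA => /and3P[bo b1 b4]; rewrite b1 b4 /= andbT -lexI.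
apply: (le_joinE bo); last by apply: (le_meet3_bot _ y0); meet_le.
apply: (@le_joinE _ _ (x1 `&` x3 `&` y1 `&` y3) (x2 `&` x3)).
- exact: leIr.
- by rewrite lexI; apply/andP; split; meet_le.
- by apply: (le_meet3_bot _ x0); meet_le.
Qed.

(** Here the first joinand is the contradictory one: it lies below [x1], [x3], [y1], [y3], while [b]
    lies below [x2] joined with [y2]. The other two joinands are the disjuncts sought. *)
Lemma circ_andF_le b :
  b <= circ `&` (x2 `|` y2) -> b <= (x3 `&` x2) `|` (y3 `&` y2).
Proof.
rewrite !(lexI b) => /andP[bo b2].
apply: (le_joinE bo); last by apply: lexUr; rewrite meetC leIxl // meetC.
apply: (@le_joinE _ _ (x1 `&` x3 `&` y1 `&` y3) (x2 `&` x3)).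
- exact: leIr.
- apply: (@le_joinE _ _ x2 y2); first by meet_le.
    by apply: (le_meet3_bot _ x0); meet_le.
  by apply: (le_meet3_bot _ y0); meet_le.
- by apply: lexUl; rewrite [x3 `&` x2]meetC; meet_le.
Qed.

End CircAnd.

(** * Soundness for one valuation in one twist structure *)

Section Soundness.
Context (v : formula -> twist_alg B) (hv : is_hom v).

Let f1 C := (val (v C)).1.1.
Let f2 C := (val (v C)).1.2.
Let f3 C := (val (v C)).2.

Let raw C : val (v C) = (f1 C, f2 C, f3 C).
Proof. by rewrite /f1 /f2 /f3; case: (val _) => [[]]. Qed.

Let circ_le C : f3 C <= f1 C `|` f2 C.
Proof. by have := valP (v C); rewrite raw => /andP[]. Qed.

Let circ0 C : f1 C `&` f2 C `&` f3 C = \bot.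
Proof. by have := valP (v C); rewrite raw => /andP[_ /eqP]. Qed.

(** The rules for disjunction reuse the [circ_and] lemmas with the first two components exchanged,
    which calls for this order. *)
Let circ0' C : f2 C `&` f1 C `&` f3 C = \bot.
Proof. by rewrite (meetC (f2 C)) circ0. Qed.

Let val_and C D : val (v (C ∧ D)%F) = and_raw (val (v C)) (val (v D)).
Proof. by case: hv => ->. Qed.

Let val_or C D : val (v (C ∨ D)%F) = or_raw (val (v C)) (val (v D)).
Proof. by case: hv => _ ->. Qed.

Let val_neg C : val (v (¬ C)%F) = neg_raw (val (v C)).
Proof. by case: hv => _ _ ->. Qed.

Let val_circ C : val (v (∘ C)%F) = circ_raw (val (v C)).
Proof. by case: hv => _ _ _ ->. Qed.

Let f1_and C D : f1 (C ∧ D)%F = f1 C `&` f1 D.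
Proof. by rewrite {1}/f1 val_and !raw. Qed.

Let f2_and C D : f2 (C ∧ D)%F = f2 C `|` f2 D.
Proof. by rewrite {1}/f2 val_and !raw. Qed.

Let f3_and C D :
  f3 (C ∧ D)%F = circ_and (f1 C) (f2 C) (f3 C) (f1 D) (f2 D) (f3 D).
Proof. by rewrite {1}/f3 val_and !raw. Qed.

Let f1_or C D : f1 (C ∨ D)%F = f1 C `|` f1 D.
Proof. by rewrite {1}/f1 val_or !raw. Qed.

Let f2_or C D : f2 (C ∨ D)%F = f2 C `&` f2 D.
Proof. by rewrite {1}/f2 val_or !raw. Qed.

Let f3_or C D :
  f3 (C ∨ D)%F = circ_and (f2 C) (f1 C) (f3 C) (f2 D) (f1 D) (f3 D).
Proof. by rewrite {1}/f3 val_or !raw. Qed.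

Let f1_neg C : f1 (¬ C)%F = f2 C.
Proof. by rewrite {1}/f1 val_neg raw. Qed.

Let f2_neg C : f2 (¬ C)%F = f1 C.
Proof. by rewrite {1}/f2 val_neg raw. Qed.

Let f3_neg C : f3 (¬ C)%F = f3 C.
Proof. by rewrite {1}/f3 val_neg raw. Qed.

Let f1_circ C : f1 (∘ C)%F = f3 C.
Proof. by rewrite {1}/f1 val_circ raw. Qed.

Let f3_circ C : f3 (∘ C)%F = \top.
Proof. by rewrite {1}/f3 val_circ raw. Qed.

Let fE := (f1_and, f1_or, f1_neg, f1_circ, f2_and, f2_or, f2_neg,
           f3_and, f3_or, f3_neg, f3_circ).

Lemma derives_le (G : set formula) (C : formula) : derives G C ->
  forall b : B, (forall D, G D -> b <= (val (v D)).1.1) ->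
  b <= (val (v C)).1.1.
Proof.
rewrite -[(val (v C)).1.1]/(f1 C).
(* Adding an assumption [D] to the context amounts to meeting the lower bound with [f1 D]. *)
have hypU (H : set formula) D b : (forall E, H E -> b <= f1 E) ->
    forall E, (H,, D) E -> b `&` f1 D <= f1 E.
  move=> bH E [HE|->]; last exact: leIr.
  by apply: leIxl; apply: bH.
elim=> {G C}
  [G C GC|G C D _ IH1 _ IH2|G C D _ IH|G C D _ IH|G C D _ IH|G C D _ IH
  |G C D E _ IH _ IH1 _ IH2|G C D _ IH|G C D _ IH
  |G C D E _ IH _ IH1 _ IH2|G C D _ IH1 _ IH2|G C D _ IH|G C D _ IH
  |G C _ IH|G C _ IH|G C D _ IH1 _ IH2 _ IH3|G C _ IH|G C|G C _ IH|G C _ IH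
  |G C D _ IH1 _ IH2|G C D _ IH|G C D _ IH|G C D _ IH|G C D _ IH
  |G C D _ IH1 _ IH2|G C D _ IH|G C D _ IH
  |G C D E _ IH _ IH1 _ IH2|G C D E _ IH _ IH1 _ IH2|G C D _ IH|G C D _ IH]
  b bG; try have := IH b bG; rewrite ?fE.
- exact: bG.
- by rewrite lexI IH1 ?IH2.
- by rewrite lexI => /andP[].
- by rewrite lexI => /andP[].
- exact: lexUl.
- exact: lexUr.
- by move=> bCD; apply: (le_joinE bCD); [apply: IH1|apply: IH2]; apply: hypU.
- exact: lexUl.
- exact: lexUr.
(* The induction hypotheses speak of first components only, so [f2] is read back as [f1] of a
   negation. *)
- rewrite -!f1_neg => bCD.
  by apply: (le_joinE bCD); [apply: IH1|apply: IH2]; apply: hypU.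
- by rewrite lexI -!f1_neg IH1 ?IH2.
- by rewrite lexI => /andP[].
- by rewrite lexI => /andP[].
- by [].
- by [].
- apply: (le_meet3_bot _ (circ0 C)); rewrite -?f1_neg -?f1_circ.
  + exact: IH2.
  + exact: IH3.
  + exact: IH1.
- by move/le_trans; apply; apply: circ_le.
- exact: lex1.
- by [].
- by [].
- by move: (IH1 b bG) (IH2 b bG); rewrite !fE; apply: le_circ_andT.
- exact: le_circ_andF1.
- exact: le_circ_andF2.
(* By duality the T-rules of disjunction are instances of the F-lemmas of conjunction, and
   conversely. *)
- exact: le_circ_andF1.
- exact: le_circ_andF2.
- by move: (IH1 b bG) (IH2 b bG); rewrite !fE; apply: le_circ_andT.
- by move/(circ_andT_le (circ0 _) (circ0 _)); rewrite lexI => /andP[].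
- by move/(circ_andT_le (circ0 _) (circ0 _)); rewrite lexI => /andP[].
- move/(circ_andF_le (circ0 _) (circ0 _)) => bCD.
  apply: (le_joinE bCD); [apply: IH1|apply: IH2].
    by have := hypU _ C^F _ bG; rewrite !fE.
  by have := hypU _ D^F _ bG; rewrite !fE.
- move/(circ_andF_le (circ0' _) (circ0' _)) => bCD.
  apply: (le_joinE bCD); [apply: IH1|apply: IH2].
    by have := hypU _ C^T _ bG; rewrite !fE.
  by have := hypU _ D^T _ bG; rewrite !fE.
- by move/(circ_andT_le (circ0' _) (circ0' _)); rewrite lexI => /andP[].
- by move/(circ_andT_le (circ0' _) (circ0' _)); rewrite lexI => /andP[].
Qed.

End Soundness.
End TwistOrder.

Lemma soundness (G : set formula) (A : formula) :
  derives G A -> entails Mat G A.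
Proof.
(* Designation is the case where the lower bound is the top element. *)
move=> dA _ [d B] v hv vG; apply/eqP; rewrite -le1x.
by apply: (derives_le hv dA) => D /vG ->.
Qed.

(** * Weakening and compactness of derivability *)

Lemma derives_sub (G H : set formula) (A : formula) :
  G `<=` H -> derives G A -> derives H A.
Proof.
move=> GH dA; elim: dA H GH => {G A}; try by move=> *; econstructor; eauto.
all: by move=> *; econstructor; eauto using setSU.
Qed.

Section Directed.
Context (I : Type).
Implicit Types (F : I -> set formula) (P Q : I -> Prop).

Definition directed F := forall i j, exists k, F i `<=` F k /\ F j `<=` F k.

Definition upward F P := forall i k, F i `<=` F k -> P i -> P k.

Lemma directed_join F P Q : directed F -> upward F P -> upward F Q ->
  (exists i, P i) -> (exists i, Q i) -> exists k, P k /\ Q k.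
Proof.
move=> dirF upP upQ [i Pi] [j Qj]; have [k [ik jk]] := dirF i j.
by exists k; split; [apply: upP Pi|apply: upQ Qj].
Qed.

Lemma upward_derives F A : upward F (fun i => derives (F i) A).
Proof. by move=> i k; apply: derives_sub. Qed.

Lemma upward_derivesU F B A : upward F (fun i => derives (F i,, B) A).
Proof. by move=> i k ik; apply: derives_sub; apply: setSU. Qed.

(** Finiteness of derivations, phrased with directed covers instead of finite subsets: this is the
    form that a chain in Zorn's lemma calls for. *)
Definition compact (G : set formula) (A : formula) :=
  forall F, directed F -> G `<=` \bigcup_i F i -> exists i, derives (F i) A.

Lemma compact_rule1 G A B : (forall H, derives H A -> derives H B) ->
  compact G A -> compact G B.
Proof.
by move=> AB cA F dirF /cA[]// i dA; exists i; apply: AB.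
Qed.

Lemma compact_rule2 G A B C :
  (forall H, derives H A -> derives H B -> derives H C) ->
  compact G A -> compact G B -> compact G C.
Proof.
move=> ABC cA cB F dirF GF.
have [k [dA dB]] := directed_join dirF (@upward_derives F A)
  (@upward_derives F B) (cA _ dirF GF) (cB _ dirF GF).
by exists k; apply: ABC.
Qed.

Lemma compact_rule3 G A B C D :
  (forall H, derives H A -> derives H B -> derives H C -> derives H D) ->
  compact G A -> compact G B -> compact G C -> compact G D.
Proof.
(* Two of the three premises are packed into one conjunction. *)
move=> ABCD cA cB; apply: (@compact_rule2 _ (A ∧ B)%F).
  by move=> H AB; apply: ABCD; [apply: AndE1 AB|apply: AndE2 AB].
exact: compact_rule2 (fun H => @AndI H A B) cA cB.
Qed.

(** Excludes the empty family, which is directed and covers the empty set but offers no index to a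
    derivation without hypotheses. *)
Context (i0 : I).

Lemma compact_derivesU F G A B : compact (G,, B) A ->
  directed F -> G `<=` \bigcup_i F i -> exists i, derives (F i,, B) A.
Proof.
move=> cA dirF GF; apply: (cA (fun i => F i,, B)).
  move=> i j; have [k [ik jk]] := dirF i j.
  by exists k; split; apply: setSU.
move=> C [/GF[i _ FC]|BC]; first by exists i => //; left.
by exists i0 => //; right.
Qed.

Lemma compact_elim_rule G A B C D :
  (forall H, derives H A -> derives (H,, B) D -> derives (H,, C) D ->
    derives H D) ->
  compact G A -> compact (G,, B) D -> compact (G,, C) D -> compact G D.
Proof.
move=> ABCD cA cB cC F dirF GF.
(* Two nested uses of directedness bring the three premises to a common index. *)
have [//|i k ik [dB dC]|||k [dA [dB dC]]] := @directed_join F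
    (fun i => derives (F i) A)
    (fun i => derives (F i,, B) D /\ derives (F i,, C) D) dirF.
- exact: upward_derives.
- by split; [apply: upward_derivesU dB|apply: upward_derivesU dC].
- exact: cA.
- apply: (directed_join dirF); do ?exact: upward_derivesU.
    exact: compact_derivesU cB dirF GF.
  exact: compact_derivesU cC dirF GF.
- by exists k; apply: ABCD.
Qed.

Lemma derives_compact (G : set formula) (A : formula) :
  derives G A -> compact G A.
Proof.
(* Settles all rules with one or two premises and no discharge. *)
elim=> {G A}; try solve
  [ move=> G *; eapply compact_rule1;
    [move=> H *; econstructor; eassumption|eassumption]
  | move=> G *; eapply compact_rule2;
    [move=> H *; econstructor; eassumption|eassumption|eassumption] ].
- by move=> G A GA F _ GF; have [i _ FA] := GF _ GA; exists i; apply: Hyp.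
- move=> G A B C _ cA _ cB _ cC; refine (compact_elim_rule _ cA cB cC) => H.
  exact: OrE.
- move=> G A B C _ cA _ cB _ cC; refine (compact_elim_rule _ cA cB cC) => H.
  exact: NegAndE.
- move=> G A B _ cA _ cB _ cC; refine (compact_rule3 _ cA cB cC) => H.
  exact: EXPcirc.
- by move=> G A F _ _; exists i0; apply: CircI.
- move=> G A B C _ cA _ cB _ cC; refine (compact_elim_rule _ cA cB cC) => H.
  exact: AndFE.
- move=> G A B C _ cA _ cB _ cC; refine (compact_elim_rule _ cA cB cC) => H.
  exact: OrTE.
Qed.

End Directed.

(** * Cut, and theories maximal among those not deriving a formula *)

Lemma derives_cut (G : set formula) (A B : formula) :
  derives G A -> derives (G,, A) B -> derives G B.
(* Cut is the elimination of [A ∨ A] with the same minor derivation used twice. *)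
Proof. by move=> GA AB; apply: (OrE (OrI1 A GA)). Qed.

Definition maximal_avoiding (A : formula) (D : set formula) : Prop :=
  ~ derives D A /\ forall B, ~ D B -> derives (D,, B) A.

Section MaximalTheory.
Context (A : formula) (D : set formula) (maxD : maximal_avoiding A D).

Let memP B : derives D B <-> D B.
Proof.
split=> [dB|]; last exact: Hyp.
have [nA ext] := maxD; apply: contrapT => /ext dA.
exact/nA/(derives_cut dB).
Qed.

Let memI B : derives D B -> D B. Proof. by move/memP. Qed.

(** The hypothesis is what a discharging rule with conclusion [A] yields once its major premise is
    in [D]; so [OrE], [NegAndE], [AndFE] and [OrTE] all give primeness in the same way. *)
Let prime B C : (derives (D,, B) A -> derives (D,, C) A -> derives D A) ->
  D B \/ D C.
Proof.
have [nA ext] := maxD => dA; apply: contrapT => /not_orP[/ext dB /ext dC].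
by apply: nA; apply: dA.
Qed.

Let consistent B : D (∘ B)%F -> D B -> D (¬ B)%F -> False.
Proof.
have [nA _] := maxD => /memP cB /memP dB /memP nB.
exact/nA/(EXPcirc _ cB dB nB).
Qed.

Let mem_and B C : D (B ∧ C)%F <-> D B /\ D C.
Proof.
split=> [/memP BC|[/memP dB /memP dC]]; last exact/memI/AndI.
by split; apply: memI; [apply: AndE1 BC|apply: AndE2 BC].
Qed.

Let mem_or B C : D (B ∨ C)%F <-> D B \/ D C.
Proof.
split=> [/memP BC|]; first by apply: prime; apply: OrE.
by case=> /memP dB; apply: memI; [apply: OrI1|apply: OrI2].
Qed.

Let mem_neg_and B C : D (¬ (B ∧ C))%F <-> D (¬ B)%F \/ D (¬ C)%F.
Proof.
split=> [/memP BC|]; first by apply: prime; apply: NegAndE.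
by case=> /memP dB; apply: memI; [apply: NegAndI1|apply: NegAndI2].
Qed.

Let mem_neg_or B C : D (¬ (B ∨ C))%F <-> D (¬ B)%F /\ D (¬ C)%F.
Proof.
split=> [/memP BC|[/memP dB /memP dC]]; last exact/memI/NegOrI.
by split; apply: memI; [apply: NegOrE1 BC|apply: NegOrE2 BC].
Qed.

Let mem_neg_neg B : D (¬ ¬ B)%F <-> D B.
Proof. by split=> /memP dB; apply: memI; [apply: DNE|apply: DNI]. Qed.

Let mem_circ B : D (∘ B)%F -> D B \/ D (¬ B)%F.
Proof. by move/memP/PEMcirc/memP/mem_or. Qed.

Let mem_circ_circ B : D (∘ ∘ B)%F.
Proof. exact/memI/CircI. Qed.

Let mem_circ_neg B : D (∘ ¬ B)%F <-> D (∘ B)%F.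
Proof. by split=> /memP dB; apply: memI; [apply: NegCircE|apply: NegCircI]. Qed.

(** Since [∘ ∘ B] is in [D], the formula [∘ B] behaves classically there. *)
Let mem_neg_circ B : D (¬ ∘ B)%F <-> ~ D (∘ B)%F.
Proof.
split=> [nB cB|ncB]; first exact: consistent (mem_circ_circ B) cB nB.
by have [|] := mem_circ (mem_circ_circ B).
Qed.

(** The right side is the third component of [and_raw] read in the two-element algebra. From left to
    right, [PEMcirc] gives [(B ∧ C)^T] or [(B ∧ C)^F], and the matching elimination rule applies. *)
Let mem_circ_and B C : D (∘ (B ∧ C))%F <->
  ((D B /\ D (∘ B)%F) /\ D C) /\ D (∘ C)%F \/ D (¬ B)%F /\ D (∘ B)%F
  \/ D (¬ C)%F /\ D (∘ C)%F.
Proof.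
split.
  move=> cBC; case: (mem_circ cBC) => BC.
    have /memP dT : D (B ∧ C)^T by apply/mem_and.
    have /memP/mem_and[cB dB] := AndTE1 dT.
    by have /memP/mem_and[cC dC] := AndTE2 dT; left.
  have /memP dF : D (B ∧ C)^F by apply/mem_and.
  right; suff: D B^F \/ D C^F by rewrite !mem_and; tauto.
  by apply: prime; apply: AndFE.
move=> h; suff [/mem_and[]|/mem_and[]//] : D (B ∧ C)^T \/ D (B ∧ C)^F by [].
case: h => [[[[dB cB] dC] cC]|[[nB cB]|[nC cC]]].
- by left; apply: memI; apply: AndTI; apply/memP/mem_and.
- by right; apply: memI; apply: AndFI1; apply/memP/mem_and.
- by right; apply: memI; apply: AndFI2; apply/memP/mem_and.
Qed.

Let mem_circ_or B C : D (∘ (B ∨ C))%F <->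
  ((D (¬ B)%F /\ D (∘ B)%F) /\ D (¬ C)%F) /\ D (∘ C)%F
  \/ D B /\ D (∘ B)%F \/ D C /\ D (∘ C)%F.
Proof.
split.
  move=> cBC; case: (mem_circ cBC) => BC; last first.
    have /memP dF : D (B ∨ C)^F by apply/mem_and.
    have /memP/mem_and[cB dB] := OrFE1 dF.
    by have /memP/mem_and[cC dC] := OrFE2 dF; left.
  have /memP dT : D (B ∨ C)^T by apply/mem_and.
  right; suff: D B^T \/ D C^T by rewrite !mem_and; tauto.
  by apply: prime; apply: OrTE.
move=> h; suff [/mem_and[]|/mem_and[]//] : D (B ∨ C)^T \/ D (B ∨ C)^F by [].
case: h => [[[[nB cB] nC] cC]|[[dB cB]|[dC cC]]].
- by right; apply: memI; apply: OrFI; apply/memP/mem_and.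
- by left; apply: memI; apply: OrTI1; apply/memP/mem_and.
- by left; apply: memI; apply: OrTI2; apply/memP/mem_and.
Qed.

Let raw B : bool * bool * bool :=
  (`[< D B >], `[< D (¬ B)%F >], `[< D (∘ B)%F >]).

Let rawP B : snapshot_pred (raw B).
Proof.
rewrite /raw; have := @mem_circ B; have := @consistent B.
case: (asboolP (D B)) => dB; case: (asboolP (D (¬ B)%F)) => nB;
  case: (asboolP (D (∘ B)%F)) => cB //= F E.
- by case: (F cB dB nB).
- by case: (E cB).
Qed.

Definition maximal_valuation (B : formula) : twist_alg bool :=
  exist _ (raw B) (rawP B).

Lemma maximal_valuation_hom : is_hom maximal_valuation.
Proof.
split=> [B C|B C|B|B]; apply: val_inj; rewrite /= /raw /=.
- rewrite (asbool_equiv_eq (mem_and B C)) (asbool_equiv_eq (mem_neg_and B C)).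
  by rewrite (asbool_equiv_eq (mem_circ_and B C)) !(asbool_and, asbool_or) orbA.
- rewrite (asbool_equiv_eq (mem_or B C)) (asbool_equiv_eq (mem_neg_or B C)).
  by rewrite (asbool_equiv_eq (mem_circ_or B C)) !(asbool_and, asbool_or) orbA.
- rewrite (asbool_equiv_eq (mem_neg_neg B)).
  by rewrite (asbool_equiv_eq (mem_circ_neg B)).
- rewrite (asbool_equiv_eq (mem_neg_circ B)) asbool_neg.
  by rewrite (asboolT (mem_circ_circ B)).
Qed.

Lemma designated_maximal_valuation B :
  designated (l := twist_matrix bool) (maximal_valuation B) <-> D B.
Proof. by split=> [/asboolP|dB] //; apply/asboolP. Qed.

End MaximalTheory.

(** * Extension by Zorn's lemma, and completeness *)

Lemma exists_maximal_avoiding (G : set formula) (A : formula) :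
  ~ derives G A -> exists2 D, G `<=` D & maximal_avoiding A D.
Proof.
move=> nGA.
(* Zorn's lemma ranges over the sets [X] added to [G], not over supersets of [G], so that the empty
   union of the empty chain is admissible. *)
have [F FP totF|X [nXA maxX]] :=
    @Zorn_bigcup formula [set X | ~ derives (G `|` X) A].
  (* The index [None] keeps the family nonempty, and covers [G], when the chain is empty. *)
  pose E (i : option {X | F X}) := if i is Some X then G `|` sval X else G.
  have dirE i j : exists k, E i `<=` E k /\ E j `<=` E k.
    case: i j => [[X FX]|] [[Y FY]|].
    - have [XY|YX] := totF _ _ FX FY.
        by exists (Some (exist _ Y FY)); split=> //; apply: setUS.
      by exists (Some (exist _ X FX)); split=> //; apply: setUS.
    - by exists (Some (exist _ X FX)); split=> //; apply: subsetUl.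
    - by exists (Some (exist _ Y FY)); split=> //; apply: subsetUl.
    - by exists None; split.
  move=> dA; have [|[[X FX]|] //] := derives_compact None dA dirE.
    move=> B [GB|[X FX XB]]; first by exists None.
    by exists (Some (exist _ X FX)) => //; right.
  exact: FP.
exists (G `|` X); first exact: subsetUl.
(* Regrouping exhibits [X] enlarged by [B], a proper superset of [X], to which maximality
   applies. *)
split=> // B /not_orP[nGB nXB]; rewrite -setUA.
apply: contrapT; apply: maxX; split; first exact: subsetUl.
by move=> /(_ B (or_intror erefl)).
Qed.

Lemma completeness (G : set formula) (A : formula) :
  entails Mat G A -> derives G A.
Proof.
move=> GA; apply: contrapT => /exists_maximal_avoiding[D GD maxD].
have [nA _] := maxD; apply/nA/Hyp/(designated_maximal_valuation maxD).
apply: GA (Mat_twist bool) _ (maximal_valuation_hom maxD) _ => B /GD DB.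
exact/designated_maximal_valuation.
Qed.

Theorem theorem5p3 (Gamma : set formula) (A : formula) :
  derives Gamma A <-> entails Mat Gamma A.
Proof. by split; [apply: soundness|apply: completeness]. Qed.
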